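(* Let $N=abN'$ with $a,b,N'$ positive integers and $\gcd(a,b)=1$. Let $\varphi\in\mathbb{C}^N$ be either the Chu sequence (in which case $N$ is odd) or the P4 sequence. Let $K=\{0,a,\dots,(bN'-1)a\}$ and $L=\{0,b,\dots,(aN'-1)b\}$, viewed as subgroups of $\mathbb{Z}/N\mathbb{Z}$. Then the Gabor system $(\varphi,K\times L)$ is a tight Gabor frame for $\mathbb{C}^N$ with frame bound $NN'$.
   Context: Vectors in $\mathbb{C}^N$ are indexed by $\mathbb{Z}/N\mathbb{Z}$, and $\langle x,y\rangle=\sum_j x[j]\overline{y[j]}$. Translation and modulation are $\tau_k(\varphi)[j]=\varphi[j-k]$ and $e_\ell(\varphi)[j]=e^{2\pi i j\ell/N}\varphi[j]$. For $\Lambda\subseteq(\mathbb{Z}/N\mathbb{Z})\times(\mathbb{Z}/N\mathbb{Z})$ (pairs (translation, modulation)), the Gabor system is the family $(\varphi,\Lambda)=\{e_\ell\tau_k\varphi:(k,\ell)\in\Lambda\}$, indexed by $\Lambda$. A finite family $\{v_i\}$ in $\mathbb{C}^N$ is a tight frame with frame bound $A>0$ if $\sum_i|\langle x,v_i\rangle|^2=A\|x\|_2^2$ for all $x\in\mathbb{C}^N$. The Chu sequence (defined for $N$ odd) is $\varphi[k]=e^{\pi i k(k-1)/N}$. The P4 sequence (any $N$) is $\varphi[k]=e^{\pi i k(k-N)/N}$. *)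

(* Defs.v *)
From HB Require Import structures.
From mathcomp Require Import all_boot all_order all_algebra.
From mathcomp Require Import complex.
From mathcomp Require Import reals trigo.

Set Implicit Arguments.
Unset Strict Implicit.
Unset Printing Implicit Defensive.

Import Order.TTheory GRing.Theory Num.Theory.
Local Open Scope ring_scope.

(* Z/NZ with N = n.+1 is the additive group 'I_n.+1; when an index occurs in  *)
(* a phase it is replaced by its representative in {0, ..., N - 1}, and every *)
(* phase below is N-periodic in the index (for [chu], only when N is odd).    *)

Definition expi (R : realType) (t : R) : R[i] := Complex (cos t) (sin t).

Definition inner (R : realType) (N : nat) (x y : 'cV[R[i]]_N) : R[i] :=
  \sum_(j < N) x j 0 * (y j 0)^*.

Definition is_tight_frame (R : realType) (N : nat) (I : finType)
    (v : I -> 'cV[R[i]]_N) (A : R) : Prop :=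
  0 < A /\
  forall x : 'cV[R[i]]_N,
    \sum_(i : I) `|inner x (v i)| ^+ 2 = A%:C%C * \sum_(j < N) `|x j 0| ^+ 2.

Section Gabor.
Variables (R : realType) (n : nat).
Local Notation N := n.+1.

Definition translate (k : 'I_N) (phi : 'cV[R[i]]_N) : 'cV[R[i]]_N :=
  \col_j phi (j - k) 0.

Definition modulate (l : 'I_N) (phi : 'cV[R[i]]_N) : 'cV[R[i]]_N :=
  \col_j (expi (2 * pi * j%:R * l%:R / N%:R) * phi j 0).

Definition gabor (phi : 'cV[R[i]]_N) (Lambda : {set 'I_N * 'I_N})
    (u : {p : 'I_N * 'I_N | p \in Lambda}) : 'cV[R[i]]_N :=
  modulate (val u).2 (translate (val u).1 phi).

Definition chu : 'cV[R[i]]_N :=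
  \col_k expi (pi * k%:R * (k%:R - 1) / N%:R).

Definition p4 : 'cV[R[i]]_N :=
  \col_k expi (pi * k%:R * (k%:R - N%:R) / N%:R).

End Gabor.

Arguments chu : clear implicits.
Arguments p4 : clear implicits.

(* The residues mod N = n.+1 of 0, d, ..., (m - 1) d. *)
Definition multiples (n d m : nat) : {set 'I_n.+1} :=
  [set inZp (i * d) | i : 'I_m].

(* Main.v *)
(** Both sequences are quadratic phases: [phi (j - k)] is the product of
    [phi j], a unimodular constant depending only on [k], and [z ^- (j * k)],
    where [z = expi (2 pi / N)]. Expanding the squares, the frame sum becomes
    a double sum over [j, j'] in which the coefficient of [x j * (x j')^*] is
    a product of two geometric sums of roots of unity. The sum over [K] vanishes
    unless [j = j' mod b N'], the one over [L] unless [j = j' mod a N'];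
    since [lcm (a N') (b N') = N], only the diagonal survives. *)
Require Import Defs.
From mathcomp Require Import all_boot all_order all_algebra.
From mathcomp Require Import complex.
From mathcomp Require Import reals trigo.
From mathcomp Require Import ring lra zify.

Set Implicit Arguments.
Unset Strict Implicit.
Unset Printing Implicit Defensive.

Import Order.TTheory GRing.Theory Num.Theory.
Local Open Scope ring_scope.

(** * Character sums over the subgroups of [Z/NZ] *)

Section RootsOfUnity.
Variable C : numClosedFieldType.

Lemma sum_expr_unity (u : C) (m : nat) :
  u ^+ m = 1 -> \sum_(i < m) u ^+ i = (m * (u == 1))%:R.
Proof.
move=> um1; case: eqP => [->|/eqP u_neq1].
  under eq_bigr do rewrite expr1n.
  by rewrite sumr_const card_ord muln1.
have := subrX1 u m; rewrite um1 subrr muln0 => /esym/eqP.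
by rewrite mulf_eq0 subr_eq0 (negPf u_neq1) => /eqP.
Qed.

Lemma conj_prim_root (N : nat) (z : C) :
  N.-primitive_root z -> z^* = z^-1.
Proof.
move=> prim_z; rewrite invC_norm.
have/eqP -> : `|z| == 1.
  rewrite -(pexpr_eq1 (prim_order_gt0 prim_z)) // -normrX.
  by rewrite (prim_expr_order prim_z) normr1.
by rewrite expr1n invr1 mul1r.
Qed.

(** The sum is geometric with ratio [z ^+ (d * j) / z ^+ (d * j')], an [m]-th root of unity because
    [d * m = N]. By primitivity the ratio is 1 exactly when [d * m] divides the difference of
    [d * j] and [d * j']. *)
Lemma sum_prim_root_subgroup (N d m : nat) (z : C) (j j' : nat) :
  N.-primitive_root z -> N = (d * m)%N ->
  \sum_(i < m) z ^+ (i * d * j) * (z ^+ (i * d * j'))^* =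
    (m * (j == j' %[mod m]))%:R.
Proof.
move=> prim_z defN.
have N_gt0 := prim_order_gt0 prim_z.
have d_gt0 : (0 < d)%N by move: N_gt0; rewrite defN muln_gt0 => /andP[].
have z_neq0 : z != 0 by rewrite (prim_root_eq0 prim_z) -lt0n.
have -> : \sum_(i < m) z ^+ (i * d * j) * (z ^+ (i * d * j'))^* =
    \sum_(i < m) (z ^+ (d * j) / z ^+ (d * j')) ^+ i.
  apply: eq_bigr => i _; rewrite rmorphXn /= (conj_prim_root prim_z) exprVn.
  by rewrite expr_div_n -!exprM ![(_ * i)%N]mulnC !mulnA.
rewrite sum_expr_unity; last first.
  rewrite expr_div_n -!exprM -!mulnA ![(_ * m)%N]mulnC !mulnA -defN.
  by rewrite !exprM (prim_expr_order prim_z) !expr1n divr1.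
rewrite -(inj_eq (mulIf (expf_neq0 (d * j') z_neq0))) mul1r.
rewrite divfK ?expf_neq0 // (eq_prim_root_expr prim_z) defN.
by rewrite -!muln_modr eqn_pmul2l.
Qed.

End RootsOfUnity.

Lemma sum_multiples (V : nmodType) (n d m : nat) (F : 'I_n.+1 -> V) :
  n.+1 = (d * m)%N ->
  \sum_(k in multiples n d m) F k = \sum_(i < m) F (inZp (i * d)).
Proof.
move=> defN; rewrite /multiples big_imset //= => i i' _ _ /(congr1 val) /=.
have d_gt0 : (0 < d)%N by case: d defN.
have lt_id (k : 'I_m) : (k * d < n.+1)%N.
  by rewrite defN mulnC ltn_pmul2l.
rewrite !modn_small // => /eqP; rewrite eqn_pmul2r // => /eqP.
exact: val_inj.
Qed.

Lemma sum_multiples_prim_root (C : numClosedFieldType) (n d m : nat) (z : C)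
    (j j' : nat) :
  n.+1.-primitive_root z -> n.+1 = (d * m)%N ->
  \sum_(k in multiples n d m) z ^+ (k * j) * (z ^+ (k * j'))^* =
    (m * (j == j' %[mod m]))%:R.
Proof.
move=> prim_z defN; rewrite sum_multiples //.
rewrite -(sum_prim_root_subgroup _ _ prim_z defN).
apply: eq_bigr => i _ /=.
(* The reduction mod [N] made by [inZp] is invisible to powers of [z]. *)
by rewrite ![z ^+ (_ %% _ * _)]exprM !(prim_expr_mod prim_z) -!exprM.
Qed.

Lemma eqn_mod_coprime_mull (a b c j j' : nat) : coprime a b ->
  (j == j' %[mod a * c]) && (j == j' %[mod b * c]) = (j == j' %[mod a * b * c]).
Proof.
(* Ordering [j] and [j'] turns each congruence into divisibility of the natural number [j - j']. *)
move=> cop_ab; wlog le_jj' : j j' / (j' <= j)%N => [th|].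
  case/orP: (leq_total j' j) => [|/th]; first exact: th.
  by rewrite ![(j' %% _)%N == _]eq_sym.
rewrite !eqn_mod_dvd // -dvdn_lcm -muln_lcml.
by move: cop_ab => /eqP gcd1; rewrite -(muln_lcm_gcd a b) gcd1 muln1.
Qed.

(** * The frame sum, stripped of unimodular factors *)

Section FrameSum.
Variables (C : numClosedFieldType) (n a b N' : nat) (z : C).
Hypotheses (defN : n.+1 = (a * b * N')%N) (cop_ab : coprime a b).
Hypothesis prim_z : n.+1.-primitive_root z.

Lemma frame_sum_prim_root (y : 'I_n.+1 -> C) :
  \sum_(k in multiples n a (b * N')) \sum_(l in multiples n b (a * N'))
     (\sum_j y j * (z ^+ (k * j) * (z ^+ (l * j))^*)) *
     (\sum_j y j * (z ^+ (k * j) * (z ^+ (l * j))^*))^* =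
  (n.+1 * N')%:R * \sum_j y j * (y j)^*.
Proof.
set K := multiples _ _ _; set L := multiples _ _ _.
pose G (A : {set 'I_n.+1}) (j j' : 'I_n.+1) : C :=
  \sum_(k in A) z ^+ (k * j) * (z ^+ (k * j'))^*.
(* The sums over [k] and [l] separate; [j] and [j'] are swapped in the second because modulation
   enters conjugated. *)
transitivity (\sum_j \sum_j' y j * (y j')^* * (G K j j' * G L j' j)).
  under eq_bigr => k _.
    under eq_bigr => l _.
      rewrite rmorph_sum mulr_suml /=.
      under eq_bigr do rewrite mulr_sumr.
      over.
    rewrite exchange_big /=.
    under eq_bigr do rewrite exchange_big /=.
    over.
  rewrite exchange_big; apply: eq_bigr => j _ /=.
  rewrite exchange_big; apply: eq_bigr => j' _ /=.
  rewrite /G mulr_suml mulr_sumr; apply: eq_bigr => k _.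
  rewrite !mulr_sumr; apply: eq_bigr => l _.
  rewrite !rmorphM /= conjCK; ring.
rewrite mulr_sumr; apply: eq_bigr => j _.
(* The constant is the product of the two subgroup orders, [(b * N') * (a * N') = N * N']. *)
have GE (j' : 'I_n.+1) : G K j j' * G L j' j = (n.+1 * N' * (j' == j))%:R.
  rewrite /G !sum_multiples_prim_root //; try by rewrite defN; nia.
  rewrite -natrM -mulnA [(_ * (a * N' * _))%N]mulnCA; congr _%:R.
  rewrite (_ : (j' == j) = (j == j' %[mod b * N']) && (j' == j %[mod a * N'])).
    rewrite -mulnb !mulnA; congr (_ * _ * _)%N; lia.
  rewrite [in X in X && _]eq_sym andbC eqn_mod_coprime_mull // -defN.
  by rewrite !modn_small.
rewrite (bigD1 j) //= GE eqxx muln1 big1 ?addr0 => [|j' /negPf ne_j'j].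
  by rewrite mulrC.
by rewrite GE ne_j'j muln0 mulr0.
Qed.

End FrameSum.

(** * The exponential and a primitive [N]-th root of unity *)

Section Phases.
Variable R : realType.
Implicit Types t u : R.

Lemma expiD t u : expi (t + u) = expi t * expi u.
Proof. by rewrite /expi cosD sinD; congr Complex; rewrite addrC. Qed.

Lemma expi0 : expi (0 : R) = 1.
Proof. by rewrite /expi cos0 sin0. Qed.

Lemma expiMn t m : expi (t *+ m) = expi t ^+ m.
Proof. by elim: m => [|m IHm]; rewrite ?mulr0n ?expi0 // mulrS exprS expiD IHm. Qed.

Lemma norm_expi t : `|expi t| = 1.
Proof. by rewrite normc_def /= cos2Dsin2 sqrtr1. Qed.

Lemma sqr_norm_complex (w : R[i]) : `|w| ^+ 2 = w * w^*.
Proof. exact: normCK. Qed.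

Lemma expi_2pi_nat m : expi ((2 * pi : R) * m%:R) = 1.
Proof.
by rewrite mulr_natr expiMn /expi mulrC mulr_natr cos2pi sin2pi expr1n.
Qed.

(** The real part is [1 - 2 sin(t/2)^2], and [sin(t/2) > 0] since [t/2] lies strictly between 0 and
    [pi]. *)
Lemma expi_neq1 t : 0 < t < pi *+ 2 -> expi t != 1.
Proof.
move=> /andP[t_gt0 t_lt2pi]; apply/eqP => /(congr1 (@complex.Re R)) /= cost1.
have sin_gt0 : 0 < sin (t / 2).
  by rewrite sin_gt0_pi // divr_gt0 //= ltr_pdivrMr // mulr_natr.
have := cos_mulr2n (t / 2); rewrite -[(t / 2) *+ 2]mulr_natr.
rewrite divfK ?pnatr_eq0 // cost1.
by rewrite cos2sin2 => cos1; have := exprn_gt0 2 sin_gt0; lra.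
Qed.

Lemma prim_root_expi n : n.+1.-primitive_root (expi (2 * pi / n.+1%:R : R)).
Proof.
set z := expi _.
have zN1 : z ^+ n.+1 = 1.
  rewrite -expiMn -[_ *+ n.+1]mulr_natr divfK ?pnatr_eq0 //.
  by rewrite -[2 * pi in LHS]mulr1 (expi_2pi_nat 1).
have [m prim_z m_dvd] := prim_order_exists (ltn0Sn n) zN1.
have m_gt0 := prim_order_gt0 prim_z.
suff -> : n.+1 = m by [].
apply/eqP; rewrite eqn_leq (dvdn_leq _ m_dvd) // andbT leqNgt; apply/negP => m_lt.
(* An order [m < N] would put the angle [2 pi m / N] strictly between 0 and [2 pi]. *)
have := prim_expr_order prim_z; rewrite -expiMn; apply/eqP/expi_neq1.
have pi2_gt0 : 0 < 2 * pi :> R by rewrite mulr_gt0 ?pi_gt0.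
rewrite -[_ *+ m]mulr_natr mulrAC divr_gt0 ?ltr0n //=; last by rewrite mulr_gt0 ?ltr0n.
by rewrite ltr_pdivrMr ?ltr0n // -[pi *+ 2]mulr_natl ltr_pM2l ?ltr_nat.
Qed.

End Phases.

(** * Quadratic phases and their Gabor systems *)

Section QuadraticPhase.
Variables (R : realType) (n c : nat).
Local Notation N := n.+1.
Hypotheses (le_cN : (c <= N)%N) (even_Nc : ~~ odd (N - c)).
Local Notation z := (expi (2 * pi / N%:R : R)).

(** The Chu sequence is the case [c = 1], the P4 sequence the case [c = N]. *)
Definition quadratic_phase (m : nat) : R[i] :=
  expi (pi * m%:R * (m%:R - c%:R) / N%:R).

(** In the exponent the linear terms in [c] are additive, so only the cross term [2 j m] of the
    square remains. *)
Lemma quadratic_phaseD j m :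
  quadratic_phase (j + m) = quadratic_phase j * quadratic_phase m * z ^+ (j * m).
Proof.
rewrite /quadratic_phase -expiMn -!expiD -[_ *+ (j * m)]mulr_natr natrM natrD; congr expi.
by field; rewrite nat1r pnatr_eq0.
Qed.

Lemma quadratic_phase_mod m : quadratic_phase (m %% N) = quadratic_phase m.
Proof.
(* The phase at [N] is [expi (pi * (N - c))]; this is where the parity of [N - c] enters. *)
have phaseN : quadratic_phase N = 1.
  rewrite -(expi_2pi_nat R (N - c)./2) /quadratic_phase; congr expi.
  rewrite -natrB // -[in LHS](odd_double_half (N - c)) (negPf even_Nc) add0n.
  by rewrite -mul2n natrM; field; rewrite nat1r pnatr_eq0.
have phaseDN k : quadratic_phase (k + N) = quadratic_phase k.
  rewrite quadratic_phaseD phaseN mulr1 mulnC exprM.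
  by rewrite (prim_expr_order (prim_root_expi R n)) expr1n mulr1.
rewrite [in RHS](divn_eq m N); elim: (m %/ N)%N => [|q IHq]; first by rewrite mul0n.
by rewrite mulSn -addnA addnC phaseDN.
Qed.

(** By periodicity [j - k] may be replaced by the natural number [j + (N - k)], and
    [z ^+ (j * (N - k))] is the inverse, hence the conjugate, of [z ^+ (k * j)]. *)
Lemma quadratic_phaseB (j k : 'I_N) :
  quadratic_phase (j - k)%R =
    quadratic_phase j * quadratic_phase (N - k) * (z ^+ (k * j))^*.
Proof.
have prim_z := prim_root_expi R n.
have z_neq0 : z != 0 by rewrite (prim_root_eq0 prim_z).
rewrite /= modnDmr quadratic_phase_mod quadratic_phaseD; congr (_ * _).
rewrite rmorphXn /= (conj_prim_root prim_z) exprVn.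
apply: (mulIf (expf_neq0 (k * j) z_neq0)).
rewrite mulVf ?expf_neq0 // -exprD [(k * j)%N]mulnC -mulnDr subnK 1?ltnW //.
by rewrite mulnC exprM (prim_expr_order prim_z) expr1n.
Qed.

Lemma quadratic_phase_gabor_tight_frame a b N' (phi : 'cV[R[i]]_N) :
  (0 < N')%N -> N = (a * b * N')%N -> coprime a b ->
  (forall k, phi k 0 = quadratic_phase k) ->
  is_tight_frame
    (@gabor R n phi (setX (multiples n a (b * N')) (multiples n b (a * N'))))
    (N * N')%:R.
Proof.
move=> N'_gt0 defN cop_ab phiE; split=> [|x]; first by rewrite ltr0n muln_gt0.
have prim_z := prim_root_expi R n.
pose F (p : 'I_N * 'I_N) := `|inner x (modulate p.2 (translate p.1 phi))| ^+ 2.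
rewrite -(big_sub _ F) /F.
under eq_bigl => p do rewrite inE.
rewrite -(pair_big (mem (multiples n a (b * N')))
                   (mem (multiples n b (a * N'))) (fun k l => F (k, l))) /=.
under [in RHS]eq_bigr do rewrite sqr_norm_complex.
(* Absorbing the phase at [j] into [x] leaves all moduli unchanged. *)
pose y j := x j 0 * (quadratic_phase j)^*.
have phase_unit m : quadratic_phase m * (quadratic_phase m)^* = 1.
  by rewrite -sqr_norm_complex norm_expi expr1n.
have normy j : y j * (y j)^* = x j 0 * (x j 0)^*.
  by rewrite rmorphM /= conjCK mulrACA [_^* * _]mulrC phase_unit mulr1.
under [in RHS]eq_bigr do rewrite -normy.
rewrite rmorph_nat -(frame_sum_prim_root defN cop_ab prim_z).
apply: eq_bigr => k _; apply: eq_bigr => l _; rewrite /F sqr_norm_complex.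
(* The phase at [N - k] does not depend on [j], so it leaves the sum and has modulus 1. *)
suff -> : inner x (modulate l (translate k phi)) =
    (quadratic_phase (N - k))^* * \sum_j y j * (z ^+ (k * j) * (z ^+ (l * j))^*).
  by rewrite rmorphM /= conjCK mulrACA [_^* * _]mulrC phase_unit mul1r.
rewrite mulr_sumr; apply: eq_bigr => j _.
rewrite !mxE phiE quadratic_phaseB.
rewrite (_ : expi _ = z ^+ (l * j)); last first.
  by rewrite -expiMn -[_ *+ (l * j)]mulr_natr natrM; congr expi; ring.
rewrite /y !rmorphM /= conjCK; ring.
Qed.

End QuadraticPhase.

Theorem proposition5p2 (R : realType) (n a b N' : nat)
    (a_gt0 : (0 < a)%N) (b_gt0 : (0 < b)%N) (N'_gt0 : (0 < N')%N)
    (defN : n.+1 = (a * b * N')%N) (cop_ab : coprime a b)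
    (phi : 'cV[R[i]]_n.+1)
    (phiE : (odd n.+1 /\ phi = chu R n) \/ phi = p4 R n) :
  is_tight_frame
    (@gabor R n phi (setX (multiples n a (b * N')) (multiples n b (a * N'))))
    (n.+1 * N')%:R.
Proof.
case: phiE => [[oddN ->]|->].
  apply: (@quadratic_phase_gabor_tight_frame R n 1) => // [|k]; last by rewrite mxE.
  by rewrite subn1.
apply: (@quadratic_phase_gabor_tight_frame R n n.+1) => // [|k]; last by rewrite mxE.
by rewrite subnn.
Qed.
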